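(* Let $n \geq 3$. Then the matrix $\mathfrak{D}_n=\big(\mathtt{des_X}(\pi\tau^{-1})\big)_{\pi,\tau\in\mathcal{S}_n}$ is diagonalizable and its spectrum is $$Sp(\mathfrak{D}_n)=\Big\{\tfrac{n!}{2}\sum_{k=1}^{n-1}X_k,\ -(n-2)!\sum_{k=1}^{n-1}X_k,\ 0\Big\},$$ with multiplicities $V_{\mathfrak{D}_n}\big(\tfrac{n!}{2}\sum_{k=1}^{n-1}X_k\big)=1$, $V_{\mathfrak{D}_n}\big(-(n-2)!\sum_{k=1}^{n-1}X_k\big)=\binom{n}{2}$, and $V_{\mathfrak{D}_n}(0)=n!-\binom{n}{2}-1$.
   Context: $\mathcal{S}_n$ is the symmetric group on $[n]=\{1,\dots,n\}$. For $\sigma\in\mathcal{S}_n$, $\mathtt{DES}(\sigma)=\{k\in[n-1] : \sigma(k)>\sigma(k+1)\}$ and $\mathtt{des_X}(\sigma)=\sum_{i\in\mathtt{DES}(\sigma)}X_i\in\mathbb{R}[X_1,\dots,X_{n-1}]$. The matrix $\mathfrak{D}_n$ has rows and columns indexed by $\mathcal{S}_n$ (in a fixed linear order, the same for rows and columns), entries in $\mathbb{R}[X_1,\dots,X_{n-1}]$. $Sp(A)$ denotes the spectrum of a square matrix $A$ and $V_A(a)$ the multiplicity of the eigenvalue $a$. *)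

(* Defs.v *)
From HB Require Import structures.
From mathcomp Require Export all_boot all_order all_fingroup all_algebra.
From mathcomp Require Export reals mpoly.
Set Implicit Arguments.
Unset Strict Implicit.
Unset Printing Implicit Defensive.
Import GRing.Theory.
Local Open Scope ring_scope.

(* Everything is 0-based: k : 'I_n.-1 stands for the position k+1 in [n-1],
   pos k and nextpos k for the positions k+1 and k+2 in [n], and 'X_k for the
   variable X_{k+1}. *)
Definition pos n (k : 'I_n.-1) : 'I_n := widen_ord (leq_pred n) k.

Lemma nextpos_subproof n (k : 'I_n.-1) : (k.+1 < n)%N.
Proof. by rewrite -ltn_predRL. Qed.

Definition nextpos n (k : 'I_n.-1) : 'I_n := Ordinal (nextpos_subproof k).

Definition DES n (s : 'S_n) : {set 'I_n.-1} :=
  [set k | (s (nextpos k) < s (pos k))%N].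

Definition desX (R : realType) n (s : 'S_n) : {mpoly R[n.-1]} :=
  \sum_(k in DES s) 'X_k.

(* e is the chosen linear order on S_n. Products of permutations in MathComp
   are composed left to right, (s * t) x = t (s x), so that the composite
   pi o tau^-1 is written tau^-1 * pi. *)
Definition desmx (R : realType) n (e : 'I_(n`!) -> 'S_n) :
    'M[{mpoly R[n.-1]}]_(n`!) :=
  \matrix_(i, j) desX R ((e j)^-1 * e i)%g.

Definition sumX (R : realType) n : {mpoly R[n.-1]} := \sum_(k < n.-1) 'X_k.

(* Diagonalizability, eigenvalues and multiplicities of a polynomial matrix are
   understood over the field of rational functions R(X_1, ..., X_{n-1}). *)
Definition ratfun (R : realType) n : fieldType := {fraction {mpoly R[n.-1]}}.

Definition to_ratfun (R : realType) n : {mpoly R[n.-1]} -> ratfun R n :=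
  @FracField.tofrac _.

(* Algebraic multiplicity. *)
Definition multiplicity (F : fieldType) m (A : 'M[F]_m) (a : F) : nat :=
  mup a (char_poly A).

(* Main.v *)
(* Write s = X_1 + ... + X_{n-1}. For positions i < j let sgn_ij(pi) be 1 if
   pi(i) > pi(j) and -1 otherwise, and let g_ij(tau) be the sum of the X_k with
   (tau(i), tau(j)) = (k, k+1) minus the sum of those with
   (tau(j), tau(i)) = (k, k+1). Then
     2 des_X(pi o tau^-1) = s + \sum_(i < j) sgn_ij(pi) g_ij(tau),
   which factors the matrix as P * Q with inner dimension 1 + 'C(n, 2).
   Exchanging the positions i and j changes the sign of both sgn_ij and g_ij,
   so their sums over S_n vanish; exchanging the values k and k+1 of tau
   preserves sgn_i'j'(tau) as soon as {tau(i'), tau(j')} <> {k, k+1}, so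
   \sum_tau g_ij(tau) sgn_i'j'(tau) = 0 for distinct pairs. Hence Q * P is
   diagonal, with entries n!/2 s (once) and -(n-2)! s ('C(n, 2) times). *)
From mathcomp Require Import zify.
Require Import Defs.
Set Implicit Arguments.
Unset Strict Implicit.
Unset Printing Implicit Defensive.
Import GRing.Theory.
Local Open Scope ring_scope.

(** * Diagonalization of a matrix product *)

(** The equation [p = m] is a hypothesis because the eigenbasis used below has [r + \rank (kermx P)]
    rows, a number only provably equal to [m]. *)
Lemma row_free_diag_conj (F : fieldType) m p (V : 'M[F]_(p, m)) (A : 'M_m)
    (d : 'rV_p) :
    p = m -> row_free V -> V *m A = diag_mx d *m V ->
  diagonalizable A /\ char_poly A = \prod_(i < p) ('X - (d 0 i)%:P).
Proof.
move=> pm; subst m; rewrite row_free_unit => Vu VA; split.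
  by exists V => //; apply/diagonalizable_forPex; exists d; apply/(simmxP Vu).
have XA : map_mx polyC V *m char_poly_mx A =
          char_poly_mx (diag_mx d) *m map_mx polyC V.
  by rewrite mulmxBr mulmxBl -!map_mxM VA scalar_mxC.
have /(congr1 determinant) := XA; rewrite !det_mulmx mulrC.
have Vn0 : \det (map_mx polyC V) != 0.
  by rewrite det_map_mx polyC_eq0 -unitfE -unitmxE.
move/(mulIf Vn0); rewrite -/(char_poly A) => ->.
rewrite -/(char_poly _) char_poly_trig ?diag_mx_is_trig //.
by apply: eq_bigr => i _; rewrite mxE eqxx.
Qed.

(* The rows of [Q] together with a basis of the kernel of [P] form an
   eigenbasis of [P *m Q]. *)
Lemma factorization_diag (F : fieldType) m r (P : 'M[F]_(m, r))
    (Q : 'M_(r, m)) (d : 'rV_r) :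
    Q *m P = diag_mx d -> (forall i, d 0 i != 0) ->
  diagonalizable (P *m Q) /\
  char_poly (P *m Q) = \prod_(i < r) ('X - (d 0 i)%:P) * 'X^(m - r).
Proof.
move=> QP dn0.
have du : diag_mx d \in unitmx.
  by rewrite unitmxE det_diag unitfE; apply/prodf_neq0 => i _.
have rP : \rank P = r.
  apply/eqP; rewrite eqn_leq rank_leq_col -{1}(mxrank_unit du) -QP.
  exact: mxrankM_maxr.
have rK : \rank (kermx P) = (m - r)%N by rewrite mxrank_ker rP.
have [K Kfree KP] : exists2 K : 'M_(\rank (kermx P), m),
    row_free K & K *m P = 0.
  exists (row_base (kermx P)); first exact: row_base_free.
  by apply/sub_kermxP; rewrite eq_row_base.
have [|||V1 V2] := @row_free_diag_conj F m _ (col_mx Q K)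
  (P *m Q) (row_mx d 0).
- by rewrite rK subnKC // -rP rank_leq_row.
(* Multiplying a vanishing combination by [P] kills its kernel part, and invertibility of
   [diag_mx d] then kills the coefficients of the rows of [Q]. *)
- apply: inj_row_free => v; rewrite -[v]hsubmxK mul_row_col => vE.
  have := congr1 (mulmx^~ P) vE.
  rewrite /= mulmxDl -!mulmxA QP KP mulmx0 addr0 mul0mx.
  move/(congr1 (mulmx^~ (invmx (diag_mx d))));
  rewrite /= mulmxK // mul0mx => v0.
  move: vE; rewrite v0 mul0mx add0r.
  have /row_freeP[K' KK'] := Kfree.
  move/(congr1 (mulmx^~ K')); rewrite /= -mulmxA KK' mulmx1 mul0mx => ->.
  exact: row_mx0.
- rewrite mul_col_mx diag_mx_row mul_block_col !mul0mx addr0 add0r.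
  by rewrite !mulmxA QP KP mul0mx linear0 mul0mx.
split=> //; rewrite V2 big_split_ord /=; congr (_ * _).
  by apply: eq_bigr => i _; rewrite row_mxEl.
rewrite (eq_bigr (fun=> 'X)) => [|i _]; last by rewrite row_mxEr mxE subr0.
by rewrite prodr_const card_ord rK.
Qed.

(** The same result with an arbitrary finite inner index, so that pairs of positions need no
    numbering. *)
Lemma kernel_factorization_diag (F : fieldType) m (S T : finType)
    (e : 'I_m -> S) (f : S -> T -> F) (g : T -> S -> F) (d : T -> F) :
    bijective e -> (forall t, d t != 0) ->
    (forall t u, \sum_s g t s * f s u = d t *+ (t == u)) ->
  let A := \matrix_(i, j) \sum_t f (e i) t * g t (e j) in
  diagonalizable A /\
  char_poly A = \prod_t ('X - (d t)%:P) * 'X^(m - #|T|).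
Proof.
move=> be dn0 gf A.
pose P : 'M_(m, #|T|) := \matrix_(i, j) f (e i) (enum_val j).
pose Q : 'M_(#|T|, m) := \matrix_(i, j) g (enum_val i) (e j).
have -> : A = P *m Q.
  apply/matrixP => i j; rewrite !mxE big_enum_val /=.
  by apply: eq_bigr => k _; rewrite !mxE.
have [||dA ->] := @factorization_diag F m #|T| P Q (\row_i d (enum_val i)).
- apply/matrixP => i j; rewrite !mxE -(inj_eq enum_val_inj) -gf.
  rewrite (reindex e) /=; last exact: onW_bij.
  by apply: eq_bigr => k _; rewrite !mxE.
- by move=> i; rewrite mxE.
split=> //; rewrite [in RHS]big_enum_val; congr (_ * _).
by apply: eq_bigr => i _; rewrite mxE.
Qed.

(** * Signs and weights on the symmetric group *)

(** These permutations form a translate of the pointwise stabilizer of [i] and [j]. *)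
Lemma card_perm_two_values (T : finType) (i j a b : T) :
    i != j -> a != b ->
  #|[set s : {perm T} | (s i == a) && (s j == b)]| = (#|T| - 2)`!.
Proof.
(* The first transposition sends [i] to [a]; the second corrects the image of [j] without moving
   [a]. *)
move=> ij ab; pose s0 := (tperm i a * tperm (tperm i a j) b)%g.
have s0i : s0 i = a.
  rewrite permM tpermL tpermD 1?eq_sym //.
  by rewrite -[X in X != _](tpermL i a) (inj_eq perm_inj).
have s0j : s0 j = b by rewrite permM tpermL.
pose A := ~: [set i; j].
have -> : [set s : {perm T} | (s i == a) && (s j == b)] =
          [set (u * s0)%g | u in [set u | perm_on A u]].
  apply/setP => s; rewrite inE; apply/andP/imsetP => [[/eqP si /eqP sj]|].
    exists (s * s0^-1)%g; last by rewrite mulgKV.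
    rewrite inE; apply/subsetP => x; rewrite !inE; apply: contra.
    by case/orP => /eqP->; rewrite permM ?si ?sj -?[in X in _ X]s0i
      -?[in X in _ X]s0j permK.
  case=> u; rewrite inE => uA ->; split;
    rewrite permM (out_perm uA) ?s0i ?s0j //;
    by rewrite !inE eqxx ?orbT.
rewrite card_imset; last exact: mulIg.
rewrite cardsE card_perm cardsCs setCK cards2 ij.
by [].
Qed.

(** This is sgn_ij; [alt_weight] below is g_ij, with field elements [x k] in place of the
    variables. *)
Definition inv_sign (F : fieldType) n (i j : 'I_n) (s : 'S_n) : F :=
  if (s j < s i)%N then 1 else - 1.

Definition adj_weight (F : fieldType) n (x : 'I_n.-1 -> F) (i j : 'I_n)
    (s : 'S_n) : F :=
  \sum_k x k *+ ((s i == pos k) && (s j == nextpos k)).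

Definition alt_weight (F : fieldType) n (x : 'I_n.-1 -> F) (i j : 'I_n)
    (s : 'S_n) : F :=
  adj_weight x i j s - adj_weight x j i s.

Lemma pos_neq_nextpos n (k : 'I_n.-1) : pos k != nextpos k.
Proof. by rewrite -val_eqE /= neq_ltn ltnSn. Qed.

Lemma inv_sign_swap (F : fieldType) n (i j : 'I_n) (s : 'S_n) :
  i != j -> inv_sign F j i s = - inv_sign F i j s.
Proof.
rewrite -(inj_eq (@perm_inj _ s)) -val_eqE /inv_sign.
by case: ltngtP; rewrite // opprK.
Qed.

Lemma inv_sign_tperm (F : fieldType) n (i j : 'I_n) (s : 'S_n) :
  i != j -> inv_sign F i j (tperm i j * s) = - inv_sign F i j s.
Proof.
by move=> ij; rewrite -inv_sign_swap // /inv_sign !permM tpermL tpermR.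
Qed.

Lemma alt_weight_tperm (F : fieldType) n (x : 'I_n.-1 -> F) (i j : 'I_n)
    (s : 'S_n) :
  alt_weight x i j (tperm i j * s) = - alt_weight x i j s.
Proof. by rewrite /alt_weight /adj_weight opprB !permM tpermL tpermR. Qed.

Lemma adj_weight_diag (F : fieldType) n (x : 'I_n.-1 -> F) (i : 'I_n)
    (s : 'S_n) :
  adj_weight x i i s = 0.
Proof.
apply: big1 => k _; case: eqP => //= ->.
by rewrite (negPf (pos_neq_nextpos k)).
Qed.

(** Reindexing by the exchange of two positions shows that the sum is its own negative. *)
Lemma sum_antisym_tperm (F : fieldType) n (i j : 'I_n) (h : 'S_n -> F) :
    (2%:R : F) != 0 -> (forall s, h (tperm i j * s)%g = - h s) ->
  \sum_s h s = 0.
Proof.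
move=> F2 hN; apply/(mulfI F2); rewrite mulr0 mulr_natl mulr2n.
rewrite [X in X + _](reindex_inj (mulgI (tperm i j))) -big_split.
rewrite big1 //= => s _.
by rewrite hN addNr.
Qed.

Lemma sum_ordered_pairs (F : fieldType) n (h : 'I_n -> 'I_n -> F) :
    (forall i, h i i = 0) ->
  \sum_(p : 'I_n * 'I_n) h p.1 p.2 =
  \sum_(p : 'I_n * 'I_n | (p.1 < p.2)%N) (h p.1 p.2 + h p.2 p.1).
Proof.
move=> h0; rewrite (bigID (fun p : 'I_n * 'I_n => (p.1 < p.2)%N)) /=.
rewrite big_split /=; congr (_ + _).
rewrite (reindex_inj (h := fun p : 'I_n * 'I_n => (p.2, p.1))) /=; last first.
  by move=> [i j] [i' j'] [-> ->].
rewrite big_mkcond [RHS]big_mkcond; apply: eq_bigr => -[i j] _ /=.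
by case: ltngtP => // /ord_inj-> /=.
Qed.

(** For each [k] only the pair of positions where [t] takes the values [pos k] and [nextpos k]
    contributes; its sign is 1 at a descent and -1 otherwise, so [x k] plus its signed copy is
    [2 x k] or 0. *)
Lemma descent_sum_factorization (F : fieldType) n (x : 'I_n.-1 -> F)
    (s t : 'S_n) :
  2%:R * (\sum_(k in DES (t^-1 * s)%g) x k) =
  \sum_k x k +
  \sum_(p : 'I_n * 'I_n | (p.1 < p.2)%N)
     inv_sign F p.1 p.2 s * alt_weight x p.1 p.2 t.
Proof.
pose h (i j : 'I_n) := inv_sign F i j s * adj_weight x i j t.
rewrite (eq_bigr (fun p => h p.1 p.2 + h p.2 p.1)); last first.
  move=> [i j] /= ij; rewrite /h [inv_sign F j i s]inv_sign_swap.
    by rewrite mulNr -mulrBr.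
  by rewrite -val_eqE neq_ltn ij.
rewrite -sum_ordered_pairs; last by move=> i; rewrite /h adj_weight_diag mulr0.
under [X in _ + X]eq_bigr do rewrite /h /adj_weight mulr_sumr.
rewrite exchange_big -big_split mulr_sumr big_mkcond /=; apply: eq_bigr => k _.
rewrite (bigD1 ((t^-1)%g (pos k), (t^-1)%g (nextpos k))) //= !permKV !eqxx.
rewrite big1 ?addr0 => [|[i j] /=]; last first.
  rewrite xpair_eqE -(inj_eq (@perm_inj _ t) i) -(inj_eq (@perm_inj _ t) j).
  rewrite !permKV => /negPf->.
  by rewrite mulr0.
rewrite inE !permM /inv_sign; case: ifP => _; last by rewrite mulN1r subrr.
by rewrite mul1r mulr_natl mulr2n.
Qed.

(** Where the weight is nonzero, [s j] is the successor of [s i], so the sign is -1. *)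
Lemma adj_weight_mul_sign (F : fieldType) n (x : 'I_n.-1 -> F) (i j : 'I_n)
    (s : 'S_n) :
  adj_weight x i j s * inv_sign F i j s = - adj_weight x i j s.
Proof.
rewrite mulr_suml -sumrN; apply: eq_bigr => k _; rewrite /inv_sign.
case: eqP => [->|_]; last by rewrite mul0r oppr0.
case: eqP => [->|_]; last by rewrite mul0r oppr0.
by rewrite ltnNge leqnSn mulrN1.
Qed.

Lemma sum_adj_weight (F : fieldType) n (x : 'I_n.-1 -> F) (i j : 'I_n) :
  i != j -> \sum_s adj_weight x i j s = (n - 2)`!%:R * \sum_k x k.
Proof.
move=> ij; rewrite exchange_big mulr_sumr; apply: eq_bigr => k _ /=.
have := card_perm_two_values ij (pos_neq_nextpos k); rewrite card_ord => <-.
rewrite mulr_natl -sumr_const.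
by rewrite [RHS]big_mkcond; apply: eq_bigr => s _; rewrite inE; case: ifP.
Qed.

(** Exchanging two consecutive values affects the relative order only of the two positions that hold
    them. *)
Lemma inv_sign_mul_tperm (F : fieldType) n (k : 'I_n.-1) (i j : 'I_n)
    (s : 'S_n) :
    ~~ ((s i == pos k) && (s j == nextpos k)) ->
    ~~ ((s j == pos k) && (s i == nextpos k)) ->
  inv_sign F i j (s * tperm (pos k) (nextpos k)) = inv_sign F i j s.
Proof.
rewrite /inv_sign !permM; move: (s i) (s j) => u v nij nji.
congr (if _ then _ else _); move: nij nji.
case: tpermP => [->|->|/eqP + /eqP]; case: tpermP => [->|->|/eqP + /eqP];
  rewrite -?val_eqE /=; lia.
Qed.

Lemma sum_alt_weight_mul_sign (F : fieldType) n (x : 'I_n.-1 -> F)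
    (p q : 'I_n * 'I_n) :
    (p.1 < p.2)%N -> (q.1 < q.2)%N ->
  \sum_s alt_weight x p.1 p.2 s * inv_sign F q.1 q.2 s =
  (- (2 * (n - 2)`!)%:R * \sum_k x k) *+ (p == q).
Proof.
case: p q => [i j] [i' j'] /= ij ij'.
have nij : i != j by rewrite -val_eqE neq_ltn ij.
have nji : j != i by rewrite eq_sym.
case: eqP => [[<- <-]|pq].
  rewrite (eq_bigr (fun s => - (adj_weight x i j s + adj_weight x j i s))).
    rewrite sumrN big_split /= !sum_adj_weight //.
    by rewrite mulr1n mulNr natrM -mulrDl -mulr2n mulr_natl.
  move=> s _; rewrite mulrBl adj_weight_mul_sign opprD.
  by rewrite (inv_sign_swap F s nji) mulrN adj_weight_mul_sign opprK.
under eq_bigr do rewrite mulrBl.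
rewrite mulr0n sumrB; apply/eqP; rewrite subr_eq0; apply/eqP.
under eq_bigr do rewrite mulr_suml; under [RHS]eq_bigr do rewrite mulr_suml.
rewrite exchange_big [RHS]exchange_big; apply: eq_bigr => k _ /=.
(* Exchanging the values [pos k] and [nextpos k] turns the condition of one half of the alternating
   weight into that of the other. *)
rewrite (reindex_inj (mulIg (tperm (pos k) (nextpos k)))) /=.
apply: eq_bigr => s _; rewrite !permM.
have tK := tpermK (pos k) (nextpos k).
rewrite !(can2_eq tK tK) tpermL tpermR andbC.
case: andP => [[/eqP sj /eqP si]|]; last by rewrite !mul0r.
(* The sign could change only if [i'], [j'] were [j], [i], against the ordering of both pairs, or
   [i], [j], against [pq]. *)
rewrite inv_sign_mul_tperm // -sj -si !(inj_eq perm_inj).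
  by apply/negP => /andP[/eqP ? /eqP ?]; subst; lia.
by apply/negP => /andP[/eqP ? /eqP ?]; subst; case: pq.
Qed.

(** * Counting pairs *)

Lemma card_ordered_pairs n :
  #|{: {p : 'I_n * 'I_n | (p.1 < p.2)%N}}| = 'C(n, 2).
Proof.
rewrite card_sig -bin2_sum big_mkord -sum1_card.
rewrite (eq_bigl (fun p : 'I_n * 'I_n => (p.1 < p.2)%N)) //.
rewrite -(pair_big_dep predT (fun i j : 'I_n => (i < j)%N) (fun _ _ => 1%N)) /=.
rewrite (exchange_big_dep predT) //=; apply: eq_bigr => j _.
rewrite (eq_bigl (fun i : 'I_n => (i < j)%N)) //.
by rewrite (big_ord_narrow (ltnW (ltn_ord j))) sum1_card card_ord.
Qed.

(** This makes the exponent of ['X] in the characteristic polynomial positive, so 0 is an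
    eigenvalue. *)
Lemma bin2_lt_fact n : (3 <= n)%N -> ('C(n, 2).+1 < n`!)%N.
Proof.
move=> n3; rewrite -(subnK n3); move: (n - 3)%N => m {n n3}.
elim: m => [//|m IH].
rewrite addSn binS bin1 factS; nia.
Qed.

(** * Characteristic polynomial and spectrum in characteristic 0 *)

Lemma descent_matrix_char_poly (F : fieldType) n m (e : 'I_m -> 'S_n)
    (x : 'I_n.-1 -> F) (s := \sum_k x k) :
    bijective e -> [pchar F] =i pred0 -> s != 0 ->
  let A := \matrix_(i, j) \sum_(k in DES ((e j)^-1 * e i)%g) x k in
  diagonalizable A /\
  char_poly A = ('X - ((n`!)%:R / 2%:R * s)%:P) *
                ('X - (- ((n - 2)`!)%:R * s)%:P) ^+ 'C(n, 2) *
                'X^(m - 'C(n, 2).+1).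
Proof.
move=> be /pcharf0P F0 sn0 A.
have F2 : (2%:R : F) != 0 by rewrite F0.
(* The [unit] summand carries the constant term [s]; the factor 1/2 is put entirely into [g]. *)
pose T := (unit + {p : 'I_n * 'I_n | (p.1 < p.2)%N})%type.
pose f (t : 'S_n) (p : T) : F :=
  if p is inr q then inv_sign F (sval q).1 (sval q).2 t else 1.
pose g (p : T) (t : 'S_n) : F :=
  if p is inr q then alt_weight x (sval q).1 (sval q).2 t / 2%:R else s / 2%:R.
pose d (p : T) : F :=
  if p is inr q then - ((n - 2)`!)%:R * s else (n`!)%:R / 2%:R * s.
have nd (q : {p : 'I_n * 'I_n | (p.1 < p.2)%N}) : (sval q).1 != (sval q).2.
  by rewrite -val_eqE neq_ltn (valP q).
have dn0 p : d p != 0.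
  by case: p => [_|q] /=; rewrite !mulf_neq0 ?oppr_eq0 ?invr_eq0 ?F0 //
    -lt0n fact_gt0.
have gf p q : \sum_t g p t * f t q = d p *+ (p == q).
  case: p q => [[]|p] [[]|q] /=.
  - under eq_bigr do rewrite mulr1.
    by rewrite sumr_const card_Sn mulr1n -[LHS]mulr_natl mulrA mulrAC.
  - rewrite -mulr_sumr.
    rewrite (sum_antisym_tperm (i := (sval q).1) (j := (sval q).2) F2) ?mulr0 // => t.
    exact: inv_sign_tperm.
  - under eq_bigr do rewrite mulr1.
    rewrite (sum_antisym_tperm (i := (sval p).1) (j := (sval p).2) F2) // => t.
    by rewrite alt_weight_tperm mulNr.
  - under eq_bigr do rewrite mulrAC.
    rewrite -mulr_suml sum_alt_weight_mul_sign ?(valP p) ?(valP q) //.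
    rewrite (inj_eq val_inj) (_ : (inr p == inr q) = (p == q)) //.
    case: eqP => _; last by rewrite !mulr0n mul0r.
    by rewrite !mulr1n natrM -mulrN mulrAC [2%:R * _]mulrC mulfK.
have [] := kernel_factorization_diag be dn0 gf.
set B := \matrix_(i, j) _; suff -> : B = A.
  move=> dA ->; split=> //; rewrite card_sum card_unit -card_ordered_pairs.
  by rewrite big_sumType /= !prodr_const card_unit expr1.
apply/matrixP => i j; rewrite !mxE big_sumType /= (bigD1 tt) //= mul1r.
rewrite [\sum_(k : unit | _) _]big1 ?addr0; last by case.
apply/(mulfI F2); rewrite descent_sum_factorization mulrDr -/s.
rewrite [2%:R * (s / _)]mulrCA divff // mulr1; congr (_ + _).
rewrite mulr_sumr; apply/esym.
apply: etrans (big_sub (fun p : 'I_n * 'I_n => (p.1 < p.2)%N) _) _.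
by apply: eq_bigr => p _; rewrite mulrCA [2%:R * _]mulrC divfK.
Qed.

Lemma descent_matrix_spectrum (F : fieldType) n (e : 'I_(n`!) -> 'S_n)
    (x : 'I_n.-1 -> F) (s := \sum_k x k)
    (a := (n`!)%:R / 2%:R * s) (b := - ((n - 2)`!)%:R * s) :
    (3 <= n)%N -> bijective e -> [pchar F] =i pred0 -> s != 0 ->
  let A := \matrix_(i, j) \sum_(k in DES ((e j)^-1 * e i)%g) x k in
  [/\ diagonalizable A,
      forall y, eigenvalue A y = (y \in [:: a; b; 0]),
      multiplicity A a = 1%N,
      multiplicity A b = 'C(n, 2) &
      multiplicity A 0 = (n`! - 'C(n, 2) - 1)%N].
Proof.
move=> n3 be F0 sn0 A; have [dA pA] := descent_matrix_char_poly be F0 sn0.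
have /pcharf0P nat0 := F0.
have C0 : (0 < 'C(n, 2))%N by rewrite bin_gt0 (leq_trans _ n3).
have lt0 : (0 < n`! - 'C(n, 2).+1)%N by rewrite subn_gt0 bin2_lt_fact.
have an0 : a != 0 by rewrite !mulf_neq0 ?invr_eq0 ?nat0 // -lt0n fact_gt0.
have bn0 : b != 0 by rewrite mulf_neq0 ?oppr_eq0 ?nat0 // -lt0n fact_gt0.
(* Twice [a - b] is [n! + 2 (n-2)!] times [s]. *)
have ab : a != b.
  rewrite -subr_eq0 -mulrBl opprK mulf_neq0 //.
  have F2 : (2%:R : F) != 0 by rewrite nat0.
  rewrite -(inj_eq (mulIf F2)) mul0r mulrDl divfK // -natrM -natrD nat0.
  by rewrite -lt0n addn_gt0 fact_gt0.
(* All three factors become powers of ['X - c%:P], so the same root and multiplicity rules apply to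
   each. *)
have X0 k : 'X^k = ('X - (0 : F)%:P) ^+ k by rewrite subr0.
have mA y : multiplicity A y =
    ((a == y) + (if b == y then 'C(n, 2) else 0) +
     (if 0%R == y then n`! - 'C(n, 2).+1 else 0))%N.
  rewrite /multiplicity pA X0 -[X in X * _ * _]expr1 !mupM ?mulf_neq0 //;
    rewrite ?expf_neq0 ?polyXsubC_eq0 //.
  by rewrite !mup_XsubCX -/s -/a -/b; case: eqP.
split=> //.
- move=> y; rewrite eigenvalue_root_char pA X0 !rootM.
  rewrite !root_exp //; try exact: mulrC.
  by rewrite !root_XsubC !inE -orbA.
- by rewrite mA eqxx ![_ == a]eq_sym (negPf ab) (negPf an0).
- by rewrite mA eqxx (negPf ab) [0 == b]eq_sym (negPf bn0) addn0.
- by rewrite mA eqxx (negPf an0) (negPf bn0) !add0n -subnDA addn1.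
Qed.

(** * Transfer to the field of rational functions *)

Theorem theorem1 (R : realType) (n : nat) (hn : (3 <= n)%N)
    (e : 'I_(n`!) -> 'S_n) (he : bijective e) :
  let D : 'M[ratfun R n]_(n`!) := map_mx (@to_ratfun R n) (desmx R e) in
  let a : ratfun R n := to_ratfun (((n`!)%:R / 2%:R) *: sumX R n) in
  let b : ratfun R n := to_ratfun (- ((n - 2)`!)%:R *: sumX R n) in
  [/\ diagonalizable D,
      forall x : ratfun R n, eigenvalue D x = (x \in [:: a; b; 0]),
      multiplicity D a = 1%N,
      multiplicity D b = 'C(n, 2) &
      multiplicity D 0 = (n`! - 'C(n, 2) - 1)%N].
Proof.
move=> D a b.
pose iota : {rmorphism {mpoly R[n.-1]} -> ratfun R n} := @FracField.tofrac _.
pose x (k : 'I_n.-1) := iota 'X_k.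
have sE : \sum_k x k = iota (sumX R n) by rewrite rmorph_sum.
have natE k : (k%:R : ratfun R n) = iota (k%:R)%:MP by rewrite !rmorph_nat.
have F0 : [pchar ratfun R n] =i pred0.
  apply/pcharf0P => k; rewrite natE tofrac_eq0 mpolyC_eq0.
  by rewrite Num.Theory.pnatr_eq0.
have sn0 : \sum_k x k != 0.
  (* Evaluating every variable at 1 sends the sum to [n - 1], which is nonzero. *)
  rewrite sE tofrac_eq0; apply/eqP => /(congr1 (meval (fun=> 1))).
  rewrite meval0 /sumX rmorph_sum /=; under eq_bigr do rewrite mevalXU.
  rewrite sumr_const card_ord => /eqP; rewrite Num.Theory.pnatr_eq0.
  by case: n hn {e he D a b iota x sE natE F0} => [|[]].
have aE : a = (n`!)%:R / 2%:R * \sum_k x k.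
  have n2 : (2%:R : R) != 0 by rewrite Num.Theory.pnatr_eq0.
  have F2 : (2%:R : ratfun R n) != 0 by move/pcharf0P: F0 => ->.
  (* The division by 2 takes place in [R] on one side and in the fraction field on the other;
     multiplying by 2 removes both. *)
  apply/(mulIf F2); rewrite sE mulrAC divfK // !natE -!rmorphM.
  congr (iota _); by rewrite -mul_mpolyC mulrAC -mpolyCM divfK.
have bE : b = - ((n - 2)`!)%:R * \sum_k x k.
  by rewrite /b sE natE -rmorphN -rmorphM -mul_mpolyC mpolyCN.
have DE : D = \matrix_(i, j) \sum_(k in DES ((e j)^-1 * e i)%g) x k.
  by apply/matrixP => i j; rewrite !mxE; apply: (rmorph_sum iota).
rewrite DE aE bE; exact: descent_matrix_spectrum.
Qed.
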